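(* Assume that $T^\#T$ and $V^\#V$ are indefinite operators on $\mathcal{H}$, that $N(T)\cap N(V)=\{0\}$, and that $\mathcal{Z}(w,z)\neq\varnothing$ for every $(w,z)\in\mathcal{K}\times\mathcal{E}$. Then there exists an open and dense subset $\mathcal{M}$ of $\mathcal{K}\times\mathcal{E}$ such that $\mathcal{Z}(w,z)$ is a singleton for every $(w,z)\in\mathcal{M}$.
   Context: $(\mathcal{H},\langle\cdot,\cdot\rangle)$ is a complex separable Hilbert space, $(\mathcal{K},[\cdot,\cdot]_{\mathcal{K}})$ and $(\mathcal{E},[\cdot,\cdot]_{\mathcal{E}})$ are complex Krein spaces (boundedness of operators and topologies refer to the norm of any associated Hilbert space; $\mathcal{K}\times\mathcal{E}$ has the product topology). $T:\mathcal{H}\to\mathcal{K}$ is a bounded linear operator with closed range and $V:\mathcal{H}\to\mathcal{E}$ is a bounded linear surjective operator; $N(\cdot)$ denotes the nullspace. $T^\#:\mathcal{K}\to\mathcal{H}$ and $V^\#:\mathcal{E}\to\mathcal{H}$ denote the adjoints, determined by $[Tx,w]_{\mathcal{K}}=\langle x,T^\#w\rangle$ and $[Vx,z]_{\mathcal{E}}=\langle x,V^\#z\rangle$ for all $x\in\mathcal H$, $w\in\mathcal K$, $z\in\mathcal E$. A selfadjoint operator on $\mathcal{H}$ is indefinite if it is neither positive nor negative semidefinite. For $(w,z)\in\mathcal{K}\times\mathcal{E}$, $\mathcal{Z}(w,z)$ is the set of vectors at which the minimum of $[Tx-w,Tx-w]_{\mathcal{K}}$ over $\{x\in\mathcal{H}:[Vx-z,Vx-z]_{\mathcal{E}}=0\}$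 is attained (empty if the minimum does not exist). *)

(* Defs.v *)
From HB Require Import structures.
From mathcomp Require Import all_boot all_order all_algebra sesquilinear.
From mathcomp Require Import complex.
From mathcomp Require Import all_classical all_reals all_analysis.
Import Order.TTheory GRing.Theory Num.Theory Num.Def.
Import numFieldNormedType.Exports.

Set Implicit Arguments.
Unset Strict Implicit.
Unset Printing Implicit Defensive.

Local Open Scope classical_set_scope.
Local Open Scope ring_scope.
Local Open Scope complex_scope.

(* Forms are linear in the first argument and conjugate-linear in the second.
   In the order of R[i], x <= y means that y - x is real and nonnegative, so
   inequalities between values f x x of a hermitian form f are inequalities
   between real numbers. *)

Definition separable (T : topologicalType) : Prop :=
  exists2 D : set T, countable D & dense D.

Section Spaces.
Variable R : realType.

Definition hilbert_space (H : completeNormedModType R[i])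
    (ip : {dot H for conjC}) : Prop :=
  forall x : H, `|x| ^+ 2 = ip x x.

Definition linear_subspace (W : lmodType R[i]) (S : set W) : Prop :=
  S 0 /\ forall (a : R[i]) (x y : W), S x -> S y -> S (a *: x + y).

(* (S, g) is a Hilbert space whose norm is that of the ambient space W.
   As W is complete, S is complete exactly when it is closed. *)
Definition hilbert_subspace (W : completeNormedModType R[i])
    (g : W -> W -> R[i]) (S : set W) : Prop :=
  [/\ linear_subspace S, closed S & forall x, S x -> `|x| ^+ 2 = g x x].

(* (W, f) is a Krein space and the norm of W is the one of the Hilbert space
   associated with some fundamental decomposition W = Wp [+] Wm. All the
   associated norms are equivalent, and only their topology and bounded
   operators are used. That Wp and Wm meet only in 0 follows from f being
   positive definite on Wp and negative definite on Wm. *)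
Definition krein_space (W : completeNormedModType R[i])
    (f : {hermitian_sym W for conjC}) : Prop :=
  exists Wp Wm : set W,
    [/\ hilbert_subspace f Wp,
        hilbert_subspace (fun x y => - f x y) Wm,
        forall x, exists xp xm, [/\ Wp xp, Wm xm & x = xp + xm],
        forall xp xm, Wp xp -> Wm xm -> f xp xm = 0
      & forall xp xm, Wp xp -> Wm xm ->
          `|xp + xm| ^+ 2 = `|xp| ^+ 2 + `|xm| ^+ 2].

End Spaces.

Section Operators.
Variable R : realType.

Definition bounded_operator (U W : normedModType R[i])
    (A : {linear U -> W}) : Prop :=
  exists M : R, forall x : U, `|A x| <= M%:C * `|x|.

Definition nullspace (U W : lmodType R[i]) (A : {linear U -> W}) : set U :=
  [set x | A x = 0].

(* adjoint ip f A w is the vector y such that f (A x) w = ip x y for all x.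
   It is unique since ip is definite, and it exists by the Riesz theorem for a
   bounded operator from a Hilbert space to a Krein space; the value 0 is
   irrelevant in that case. *)
Definition adjoint (H W : completeNormedModType R[i])
    (ip : {dot H for conjC}) (f : {hermitian_sym W for conjC})
    (A : {linear H -> W}) (w : W) : H :=
  xget 0 [set y | forall x : H, f (A x) w = ip x y].

Definition positive_semidefinite (H : lmodType R[i])
    (ip : {dot H for conjC}) (A : H -> H) : Prop :=
  forall x, 0 <= ip (A x) x.

Definition negative_semidefinite (H : lmodType R[i])
    (ip : {dot H for conjC}) (A : H -> H) : Prop :=
  forall x, ip (A x) x <= 0.

Definition indefinite (H : lmodType R[i])
    (ip : {dot H for conjC}) (A : H -> H) : Prop :=
  ~ positive_semidefinite ip A /\ ~ negative_semidefinite ip A.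

End Operators.

Section Problem.
Variables (R : realType) (H K E : completeNormedModType R[i]).
Variables (fK : {hermitian_sym K for conjC}) (fE : {hermitian_sym E for conjC}).
Variables (T : {linear H -> K}) (V : {linear H -> E}).

Definition feasible (z : E) : set H := [set x | fE (V x - z) (V x - z) = 0].

Definition minimizers (w : K) (z : E) : set H :=
  [set x | feasible z x /\
    forall y, feasible z y ->
      fK (T x - w) (T x - w) <= fK (T y - w) (T y - w)].

End Problem.

(* Main.v *)
(* Put a(x,y) = [Tx,Ty] and b(x,y) = [Vx,Vy]. As b is indefinite, the S-lemma
   applied to the homogenized problem shows that each minimizer x for (w,z) has
   a multiplier l with a + l b >= 0 and
   [Tx - w, Th] + l [Vx - z, Vh] = 0 for all h,
   and that two minimizers differ by an element of the kernel of a + l b.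
   Call l degenerate if a + l b is positive semidefinite with a nonzero kernel.
   Then l is an endpoint of the interval of all l with a + l b >= 0, because at an
   interior l the kernel is annihilated by both a and b, hence zero. So at most
   two l are degenerate, and 0 is not, as a is indefinite. If n <> 0 is in the
   kernel for a degenerate l, taking h = n shows that l is a multiplier only for
   data (w,z) in the closed hyperplane [w, Tn] + l [z, Vn] = 0. The complement of
   these at most two hyperplanes is open and dense. *)

Require Import Defs.
From HB Require Import structures.
From mathcomp Require Import all_boot all_order all_algebra sesquilinear.
From mathcomp Require Import complex ring lra.
From mathcomp Require Import all_classical all_reals all_analysis.
Import Order.TTheory GRing.Theory Num.Theory Num.Def.
Import numFieldNormedType.Exports.

Set Implicit Arguments.
Unset Strict Implicit.
Unset Printing Implicit Defensive.

Local Open Scope classical_set_scope.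
Local Open Scope ring_scope.
Local Open Scope complex_scope.

Local Notation Re := complex.Re.
Local Notation Im := complex.Im.

(** * Hermitian forms over the complex numbers and the S-lemma *)

Section HermitianForms.
Context {R : realType}.
Implicit Types (a b c : R[i]).

Lemma ReM a b : Re (a * b) = Re a * Re b - Im a * Im b.
Proof. by case: a b => [? ?] [? ?]. Qed.

Lemma ReD a b : Re (a + b) = Re a + Re b.
Proof. exact: raddfD. Qed.

Lemma ReJ a : Re (conjC a) = Re a.
Proof. by case: a. Qed.

Lemma ReMr (r : R) a : Re (r%:C * a) = r * Re a.
Proof. by rewrite ReM /= mul0r subr0. Qed.

Lemma conj_real (r : R) : conjC (r%:C : R[i]) = r%:C.
Proof. exact: conjc_real. Qed.

Lemma conjMr (r : R) a : conjC (r%:C * a) = r%:C * conjC a.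
Proof. by rewrite rmorphM; congr (_ * _); exact: conjc_real. Qed.

Definition sqnorm a : R := Re a ^+ 2 + Im a ^+ 2.

Lemma mulJc a : a * conjC a = (sqnorm a)%:C.
Proof. by case: a => x y; rewrite /sqnorm; simpc; congr (_ +i* _); ring. Qed.

Lemma sqnormMr (r : R) a : sqnorm (r%:C * a) = r ^+ 2 * sqnorm a.
Proof. by case: a => x y; rewrite /sqnorm; simpc => /=; ring. Qed.

Lemma sqnorm_ge0 a : 0 <= sqnorm a.
Proof. by rewrite addr_ge0 ?sqr_ge0. Qed.

Lemma sqnorm_eq0 a : (sqnorm a == 0) = (a == 0).
Proof. by rewrite -(inj_eq (@complexI R)) -mulJc mulf_eq0 conjc_eq0 orbb. Qed.

Lemma sqnorm_gt0 a : (0 < sqnorm a) = (a != 0).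
Proof. by rewrite lt0r sqnorm_eq0 sqnorm_ge0 andbT. Qed.

Lemma exists_unit_orthogonal a :
  exists c, sqnorm c = 1 /\ Re (c * a) = 0.
Proof.
have [->|a0] := eqVneq a 0.
  by exists 1; rewrite mulr0 /sqnorm /= expr1n expr0n addr0.
have s0 : 0 < Num.sqrt (sqnorm a) by rewrite sqrtr_gt0 sqnorm_gt0.
(* The witness is ['i] times the conjugate of [a], divided by the modulus of [a]; its product with
   [a] is purely imaginary. *)
exists ((Num.sqrt (sqnorm a))^-1%:C * (Im a +i* Re a)); split.
  have e : sqnorm (Im a +i* Re a) = Num.sqrt (sqnorm a) ^+ 2.
    by rewrite sqr_sqrtr ?sqnorm_ge0 // /sqnorm /= addrC.
  by rewrite sqnormMr e -exprMn mulVf ?expr1n // gt_eqF.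
by rewrite -mulrA ReMr ReM /= mulrC; ring.
Qed.

Definition hermitian_form {U : lmodType R[i]} (f : U -> U -> R[i]) : Prop :=
  (forall a x y z, f (a *: x + y) z = a * f x z + f y z) /\
  (forall x y, f x y = conjC (f y x)).

(** Taking the real part loses nothing, since [f x x] is real for hermitian [f]; it places all order
    arguments in [R]. *)
Definition quad {U : lmodType R[i]} (f : U -> U -> R[i]) (x : U) : R :=
  Re (f x x).

Lemma hermitian_sym_form (U : lmodType R[i]) (f : {hermitian_sym U for conjC}) :
  hermitian_form f.
Proof.
split=> [a x y z|x y]; first by rewrite linearPl.
by rewrite hermC expr0 mul1r.
Qed.

Lemma hermitian_form_comp (U W : lmodType R[i]) (f : W -> W -> R[i])
    (A : U -> W) : linear A ->
  hermitian_form f -> hermitian_form (fun x y => f (A x) (A y)).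
Proof. by move=> lA [fl fs]; split=> [a x y z|x y]; [rewrite lA fl | exact: fs]. Qed.

Lemma hermitian_form_comb (U : lmodType R[i]) (f g : U -> U -> R[i]) (r : R) :
  hermitian_form f -> hermitian_form g ->
  hermitian_form (fun x y => f x y + r%:C * g x y).
Proof.
case=> fl fs [gl gs]; split=> [a x y z|x y]; first by rewrite fl gl; ring.
by rewrite fs gs rmorphD /= conjMr.
Qed.

Section Theory.
Context {U : lmodType R[i]} {f : U -> U -> R[i]} (hf : hermitian_form f).
Implicit Types (x y z : U).

Lemma hformDl x y z : f (x + y) z = f x z + f y z.
Proof. by have [fl _] := hf; rewrite -[x]scale1r fl mul1r scale1r. Qed.

Lemma hform0l z : f 0 z = 0.
Proof. by apply: (addrI (f 0 z)); rewrite -hformDl !addr0. Qed.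

Lemma hformZl a x z : f (a *: x) z = a * f x z.
Proof. by have [fl _] := hf; rewrite -[_ *: x]addr0 fl hform0l addr0. Qed.

Lemma hformC x y : f x y = conjC (f y x).
Proof. by case: hf. Qed.

Lemma hformDr x y z : f x (y + z) = f x y + f x z.
Proof. by rewrite hformC hformDl rmorphD /= -!hformC. Qed.

Lemma hformZr a x z : f x (a *: z) = conjC a * f x z.
Proof. by rewrite hformC hformZl rmorphM /= -hformC. Qed.

Lemma hformE x : f x x = (quad f x)%:C.
Proof.
have := hformC x x; rewrite /quad; case: (f x x) => u v [].
move=> /eqP; rewrite -subr_eq0 opprK -mulr2n mulrn_eq0 /= => /eqP ->.
by [].
Qed.

Lemma quadD x y : quad f (x + y) = quad f x + quad f y + 2 * Re (f x y).
Proof.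
rewrite /quad hformDl !hformDr (hformC y x) !ReD ReJ; ring.
Qed.

Lemma quadZ a x : quad f (a *: x) = sqnorm a * quad f x.
Proof. by rewrite /quad hformZl hformZr mulrA mulJc ReMr. Qed.

Lemma quadZr (r : R) x : quad f (r%:C *: x) = r ^+ 2 * quad f x.
Proof. by rewrite quadZ /sqnorm /= expr0n addr0. Qed.

(** Along [s * conjC (f x y) *: x + y] the form is affine in [s] with slope [2 * N], so
    nonnegativity forces [N = 0]. The chosen [s] would give the value -1. *)
Lemma psd_kernel x : (forall y, 0 <= quad f y) -> quad f x = 0 ->
  forall y, f x y = 0.
Proof.
move=> f0 fx y; apply/eqP; apply: contraT; rewrite -sqnorm_gt0.
set N := sqnorm _ => N0.
set s := - (quad f y + 1) / (2 * N).
have := f0 ((s%:C * conjC (f x y)) *: x + y).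
rewrite quadD quadZ fx mulr0 add0r hformZl -mulrA [conjC _ * _]mulrC mulJc ReMr /=.
rewrite -/N /s => h; suff : (0 : R) <= -1 by lra.
by rewrite (le_trans h) // le_eqVlt; apply/orP; left; apply/eqP; field; rewrite gt_eqF.
Qed.

End Theory.

(* Rotating [y] by a unimodular [c] makes the cross term of [g] purely
   imaginary, so that both [s x + t c y] and [s x - t c y] are [g]-neutral. *)
Lemma quad_cross (U : lmodType R[i]) (f g : U -> U -> R[i]) x y :
  hermitian_form f -> hermitian_form g ->
  (forall v, quad g v = 0 -> 0 <= quad f v) ->
  0 < quad g x -> quad g y < 0 ->
  0 <= quad f y * quad g x - quad f x * quad g y.
Proof.
move=> hf hg fg gx gy.
have [c [c1 cg]] := exists_unit_orthogonal (g y x).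
have cg' : Re (g x (c *: y)) = 0 by rewrite hformC // ReJ hformZl.
(* The weights satisfy [t ^+ 2 = quad g x] and [s ^+ 2 = - quad g y], so the diagonal terms of [g]
   cancel. *)
have sx := sqr_sqrtr (ltW gx); set t := Num.sqrt _ in sx.
have gy' : 0 <= - quad g y by lra.
have sy := sqr_sqrtr gy'; set s := Num.sqrt _ in sy.
have cross r : Re (g (s%:C *: x) (r%:C *: (c *: y))) = 0.
  by rewrite hformZl // hformZr // conj_real !ReMr cg' !mulr0.
have neutral r : r ^+ 2 = quad g x ->
    0 <= s ^+ 2 * quad f x + r ^+ 2 * quad f y
         + 2 * (r * Re (f (s%:C *: x) (c *: y))).
  move=> er; have := fg (s%:C *: x + r%:C *: (c *: y)).
  rewrite !quadD // cross !quadZr // !quadZ // c1 er sy hformZr // conj_real.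
  by rewrite ReMr !mul1r; apply; ring.
(* Adding the inequalities for [t] and [- t] removes the cross term of [f]. *)
have h1 := neutral t sx; have := neutral (- t); rewrite sqrrN => /(_ sx) h2.
rewrite sx sy in h1 h2; nra.
Qed.

(** Vectors with [quad g > 0] bound [l] from below by [- f / g], those with [quad g < 0] bound it
    from above by [f / - g]. By [quad_cross] every lower bound is at most every upper one, so the
    supremum of the lower bounds works. *)
Lemma s_lemma (U : lmodType R[i]) (f g : U -> U -> R[i]) :
  hermitian_form f -> hermitian_form g ->
  (exists x, 0 < quad g x) -> (exists y, quad g y < 0) ->
  (forall v, quad g v = 0 -> 0 <= quad f v) ->
  exists l : R, forall v, 0 <= quad f v + l * quad g v.
Proof.
move=> hf hg [x0 gx0] [y0 gy0] fg.
pose A := [set - quad f x / quad g x | x in [set x | 0 < quad g x]].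
have ubA y : quad g y < 0 -> ubound A (quad f y / - quad g y).
  move=> gy _ [x /= gx <-]; have := quad_cross hf hg fg gx gy.
  by move=> h; rewrite ler_pdivrMr // mulrAC ler_pdivlMr; lra.
have supA : has_sup A.
  split; first by exists (- quad f x0 / quad g x0), x0.
  by exists (quad f y0 / - quad g y0); exact: ubA.
exists (sup A) => v; have [gv|gv|gv] := ltgtP (quad g v) 0.
- have : sup A <= quad f v / - quad g v by apply: ge_sup (ubA _ gv); case: supA.
  by rewrite ler_pdivlMr; lra.
- have : - quad f v / quad g v <= sup A by apply: ub_le_sup; [case: supA|exists v].
  by rewrite ler_pdivrMr //; lra.
- by rewrite gv mulr0 addr0 fg.
Qed.

End HermitianForms.

(** * Existence of Lagrange multipliers *)

Section Multiplier.
Context {R : realType} {H K E : completeNormedModType R[i]}.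
Context {fK : {hermitian_sym K for conjC}} {fE : {hermitian_sym E for conjC}}.
Context {T : {linear H -> K}} {V : {linear H -> E}}.

Local Notation qK := (quad (fK : K -> K -> R[i])).
Local Notation qE := (quad (fE : E -> E -> R[i])).
Local Notation a := (fun x y : H => fK (T x) (T y)).
Local Notation b := (fun x y : H => fE (V x) (V y)).

Let hK := hermitian_sym_form fK.
Let hE := hermitian_sym_form fE.

Lemma hermitian_form_pull (W : completeNormedModType R[i])
    (f : {hermitian_sym W for conjC}) (A : {linear H -> W}) :
  hermitian_form (fun x y => f (A x) (A y)).
Proof. exact: hermitian_form_comp (linearP A) (hermitian_sym_form f). Qed.

Lemma feasibleE z x : feasible fE V z x <-> qE (V x - z) = 0.
Proof.
rewrite /feasible /= (hformE hE); split=> [|->//].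
by move=> /(congr1 (@complex.Re R)).
Qed.

Lemma minimizersE w z x : minimizers fK fE T V w z x <->
  qE (V x - z) = 0 /\
  forall y, qE (V y - z) = 0 -> qK (T x - w) <= qK (T y - w).
Proof.
split=> -[/feasibleE fx mx]; split=> // y /feasibleE fy; have := mx y fy;
by rewrite !(hformE hK) lecR.
Qed.

(* Homogenizing the problem to [H * C] turns it into an S-lemma for the forms
   [[T g + t s, T g + t s] - m |t|^2] and [b g], the first vanishing with the
   second at the minimizer [(k, 1)]. *)
Lemma multiplier_exists w z x :
  (exists u, 0 < quad b u) -> (exists u, quad b u < 0) ->
  (forall v, quad b v = 0 -> 0 <= quad a v) ->
  range V (V x - z) -> minimizers fK fE T V w z x ->
  exists l : R, (forall v, 0 <= quad a v + l * quad b v) /\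
    forall h, fK (T x - w) (T h) + l%:C * fE (V x - z) (V h) = 0.
Proof.
move=> [up bp] [un bn] ab [k _ Vk] /minimizersE[fx mx].
pose U : lmodType R[i] := (H * R[i]^o)%type.
(* Since [V k = V x - z], the shift by [x - k] absorbs [z]: [V (x - k + g) - z = V g]. The
   constraint becomes homogeneous, and [s] collects the constant part of the objective. *)
have [s hs] : exists s, T (x - k) - w = s by exists (T (x - k) - w).
pose m := qK (T x - w).
pose F1 (p q : U) := fK (T p.1 + p.2 *: s) (T q.1 + q.2 *: s).
pose F2 (p q : U) : R[i] := p.2 * conjC q.2.
pose F (p q : U) := F1 p q + (- m)%:C * F2 p q.
pose G (p q : U) := fE (V p.1) (V q.1).
have Tks : T k + s = T x - w by rewrite -hs linearB addrA [T k + _]addrC subrK.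
have hF : hermitian_form F.
  apply: hermitian_form_comb.
    apply: hermitian_form_comp hK => c p q.
    rewrite -[(c *: p + q).1]/(c *: p.1 + q.1) -[(c *: p + q).2]/(c * p.2 + q.2).
    by rewrite linearP scalerDl scalerDr -scalerA addrACA.
  split=> [c p q r|p q]; rewrite /F2.
    by rewrite -[(c *: p + q).2]/(c * p.2 + q.2) mulrDl mulrA.
  by rewrite rmorphM /= conjCK mulrC.
have hG : hermitian_form G.
  by apply: hermitian_form_comp hE => c p q /=; rewrite linearP.
have qF g t : quad F (g, t) = qK (T g + t *: s) - m * sqnorm t.
  by rewrite {1}/quad /F /F2 ReD ReMr mulJc mulNr.
have [l Fl] : exists l : R, forall p, 0 <= quad F p + l * quad G p.
  apply: s_lemma => //.
  - by exists (up, 0).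
  - by exists (un, 0).
  (* At [t = 0] the claim is [ab]; otherwise division by [t] leads to the feasible point
     [x - k + g'], where minimality of [x] applies. *)
  - move=> [g t] Gg; rewrite qF; have [->|t0] := eqVneq t 0.
      by rewrite /sqnorm /= expr0n addr0 mulr0 subr0 scale0r addr0; exact: ab.
    have st : 0 < sqnorm t by rewrite sqnorm_gt0.
    have [g' eg] : exists g', g = t *: g'.
      by exists (t^-1 *: g); rewrite scalerA divff // scale1r.
    move: Gg; rewrite {1}/quad /G /= -/(qE (V g)) eg.
    rewrite (linearZ_LR T) (linearZ_LR V) -scalerDr.
    rewrite !quadZ // => /eqP; rewrite mulf_eq0 gt_eqF //= => /eqP Gg.
    have : m <= qK (T (x - k + g') - w).
      by apply: mx; rewrite linearD linearB Vk subKr addrAC subrr add0r.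
    rewrite linearD addrAC addrC hs mulrC -mulrBl => h.
    by rewrite mulr_ge0 ?subr_ge0 // ltW.
exists l; split=> [v|h].
  have := Fl (v, 0).
  by rewrite qF /sqnorm /= expr0n addr0 mulr0 subr0 scale0r addr0.
(* The semidefinite form [F + l G] vanishes at [(k, 1)], so this vector lies in its kernel; pairing
   with [(h, 0)] is stationarity. *)
have := psd_kernel (hermitian_form_comb l hF hG) (x := (k, 1)) _ _ (h, 0).
rewrite /F /F1 /F2 /G /= !scale1r scale0r addr0 rmorph0 mul1r mulr0 addr0 Tks Vk.
apply=> [p|]; first by rewrite {1}/quad ReD ReMr; exact: Fl.
rewrite {1}/quad ReD ReMr -[Re (F _ _)]/(quad F _) qF /G /= scale1r Tks Vk.
by rewrite -[Re (fE _ _)]/(qE _) fx mulr0 /sqnorm /= expr1n expr0n !addr0 mulr1 subrr.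
Qed.

End Multiplier.

(** * Indefiniteness in terms of quadratic forms *)

Section Indefinite.
Context {R : realType} {H W : completeNormedModType R[i]}.
Context {ip : {dot H for conjC}} {f : {hermitian_sym W for conjC}}.
Context {A : {linear H -> W}}.

Local Notation q := (quad (fun x y : H => f (A x) (A y))).

(* When [adjoint] takes its default value [0], so does the form. *)
Lemma adjoint_quad x :
  ip (adjoint ip f A (A x)) x = (q x)%:C \/ ip (adjoint ip f A (A x)) x = 0.
Proof.
rewrite /adjoint; case: xgetP => [y _ /(_ x) fy|_]; last by right; rewrite linear0l.
have ipC : ip y x = conjC (ip x y) := hformC (hermitian_sym_form ip) y x.
left; rewrite ipC -fy.
by rewrite (hformE (hermitian_sym_form f)); exact: conj_real.
Qed.

Lemma indefinite_quad : indefinite ip (adjoint ip f A \o A) ->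
  (exists x, 0 < q x) /\ (exists x, q x < 0).
Proof.
case=> npos nneg; split; apply: contrapT => nx.
  apply: nneg => x /=; case: (adjoint_quad x) => -> //.
  by rewrite (lecR _ 0) leNgt; apply/negP => qx; apply: nx; exists x.
apply: npos => x /=; case: (adjoint_quad x) => -> //.
by rewrite (lecR 0) leNgt; apply/negP => qx; apply: nx; exists x.
Qed.

End Indefinite.

(** * A bound of Cauchy-Schwarz type for semidefinite forms *)

Section SemidefiniteBound.
Context {R : realType} {W : lmodType R[i]} {S : set W}.
Context {f : W -> W -> R[i]} (hf : hermitian_form f).
Hypotheses (hS : linear_subspace S) (fS : forall x, S x -> 0 <= quad f x).

Lemma subspaceZ c x : S x -> S (c *: x).
Proof. by case: hS => S0 SP Sx; rewrite -[_ *: _]addr0; exact: SP. Qed.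

Lemma subspaceD x y : S x -> S y -> S (x + y).
Proof. by case: hS => S0 SP Sx Sy; rewrite -[x]scale1r; exact: SP. Qed.

Lemma Re_le_quad c x y : sqnorm c = 1 -> S x -> S y ->
  - (2 * Re (c * f x y)) <= quad f x + quad f y.
Proof.
move=> c1 Sx Sy; have := fS (subspaceD (subspaceZ c Sx) Sy).
by rewrite quadD // quadZ // c1 hformZl // mul1r; lra.
Qed.

(** Taking [c] among 1, -1, ['i], [- 'i] in [Re_le_quad] bounds the real and imaginary parts of
    [f x y] by half the right-hand side. *)
Lemma norm_le_quad x y : S x -> S y ->
  `|f x y| <= (quad f x + quad f y)%:C.
Proof.
move=> Sx Sy.
have B c : sqnorm c = 1 -> - (2 * Re (c * f x y)) <= quad f x + quad f y.
  by move=> c1; exact: Re_le_quad.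
have /B : sqnorm (1 : R[i]) = 1 by rewrite /sqnorm /=; ring.
have /B : sqnorm (-1 : R[i]) = 1 by rewrite /sqnorm /=; ring.
have /B : sqnorm ('i : R[i])%C = 1 by rewrite /sqnorm /=; ring.
have /B : sqnorm (- 'i : R[i])%C = 1 by rewrite /sqnorm /=; ring.
rewrite !ReM /= => h1 h2 h3 h4.
have q0 : 0 <= quad f x + quad f y by rewrite addr_ge0 ?fS.
rewrite normc_def lecR -(ger0_norm q0) -sqrtr_sqr ler_wsqrtr //.
nra.
Qed.

End SemidefiniteBound.

(** * Nondegeneracy and continuity of Krein space forms *)

Section Krein.
Context {R : realType} {W : completeNormedModType R[i]}.
Context {f : {hermitian_sym W for conjC}} (hf : krein_space f).

Let hff := hermitian_sym_form f.

(** Pairing [u] with its own components in a fundamental decomposition isolates their squared norms,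
    up to sign. *)
Lemma krein_nondegenerate u : (forall v, f u v = 0) -> u = 0.
Proof.
case: hf => Wp [Wm [[_ _ np] [_ _ nm] dec orth _]] fu.
have [xp [xm [Wxp Wxm e]]] := dec u.
have fpm := orth _ _ Wxp Wxm.
have xp0 : xp = 0.
  apply/eqP; rewrite -normr_eq0 -sqrf_eq0 np //.
  by have := fu xp; rewrite e hformDl // (hformC hff xm) fpm rmorph0 addr0 => ->.
have xm0 : xm = 0.
  apply/eqP; rewrite -normr_eq0 -sqrf_eq0 nm // oppr_eq0.
  by have := fu xm; rewrite e hformDl // fpm add0r => ->.
by rewrite e xp0 xm0 addr0.
Qed.

Lemma hilbert_subspace_bound (g : W -> W -> R[i]) (S : set W) x y :
  hermitian_form g -> hilbert_subspace g S -> S x -> S y ->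
  `|g x y| <= `|x| ^+ 2 + `|y| ^+ 2.
Proof.
move=> hg [sS _ nS] Sx Sy; rewrite !nS // !(hformE hg) -rmorphD.
apply: (norm_le_quad hg sS) => // z Sz.
by rewrite -lecR -(hformE hg) -nS // exprn_ge0.
Qed.

(** Orthogonality leaves only the pairings within [Wp] and within [Wm], where [f] and [- f] are
    semidefinite; the Pythagorean identity recombines the two bounds. *)
Lemma krein_bound u v : `|f u v| <= `|u| ^+ 2 + `|v| ^+ 2.
Proof.
case: hf => Wp [Wm [hp hm dec orth pyth]].
have [up [um [Wup Wum ->]]] := dec u; have [vp [vm [Wvp Wvm ->]]] := dec v.
rewrite (pyth _ _ Wup Wum) (pyth _ _ Wvp Wvm) (hformDl hff) !(hformDr hff).
rewrite (orth _ _ Wup Wvm) (hformC hff um vp) (orth _ _ Wvp Wum) rmorph0.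
rewrite addr0 add0r addrACA.
rewrite (le_trans (ler_normD _ _)) // lerD //.
  exact: hilbert_subspace_bound hp Wup Wvp.
rewrite -normrN.
have hN : hermitian_form (fun x y => - f x y).
  split=> [c x y z|x y]; first by rewrite linearPl /= opprD mulrN.
  by rewrite (hformC hff x y) rmorphN.
exact: hilbert_subspace_bound hN hm Wum Wvm.
Qed.

Lemma krein_continuous v : continuous ((fun u => f u v) : W -> R[i]^o).
Proof.
have lin : linear ((fun u => f u v) : W -> R[i]^o) by move=> c x y; rewrite linearPl.
pose g : {linear W -> R[i]^o} := HB.pack ((fun u => f u v) : W -> R[i]^o)
  (GRing.isLinear.Build _ _ _ _ _ lin).
suff : continuous g by [].
move=> x; apply: bounded_linear_continuous; apply/ex_bound.
exists (1 + `|v| ^+ 2); apply/nbhs_norm0P; exists 1 => //= y y1.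
apply: le_trans (krein_bound y v) _; rewrite lerD2r expr_le1 //; exact: ltW.
Qed.

End Krein.

(** * Complements of closed hyperplanes *)

Section NonvanishingFunctional.
Context {R : realType} {X : normedModType R[i]} {phi : X -> R[i]^o}.

(** For density, a zero [p] of [phi] is moved to [t *: e + p] with small [t != 0], where [phi]
    equals [t * phi e]. *)
Lemma nonvanishing_open_dense e :
  continuous phi -> linear phi -> phi e != 0 ->
  open [set p | phi p != 0] /\ dense [set p | phi p != 0].
Proof.
move=> phic phil phie; split.
  have -> : [set p | phi p != 0] = phi @^-1` (~` [set 0]).
    by apply/seteqP; split=> p /= /eqP.
  apply: (continuousP phi).1 => //; apply: closed_openC.
  by apply: accessible_closed_set1; apply: hausdorff_accessible; exact: norm_hausdorff.
move=> O [p Op] oO; have [p0|p0] := eqVneq (phi p) 0; last by exists p.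
have ct : (t *: e + p) @[t --> (0 : R[i]^o)^'] --> p.
  apply: cvg_within_filter.
  suff : (t *: e + p) @[t --> (0 : R[i]^o)] --> 0 *: e + p.
    by rewrite scale0r add0r.
  by apply: cvgD (cvgZr_tmp cvg_id) (cvg_cst p); exact: (nbhs_filter (0 : R[i]^o)).
have Onear : \forall t \near (0 : R[i]^o)^', O (t *: e + p).
  by apply: ct; exact: open_nbhs_nbhs.
have [t [Ot t0]] := filter_ex (filterI Onear (nbhs_dnbhs_neq (0 : R[i]^o))).
exists (t *: e + p); split=> //=.
by rewrite phil p0 addr0 mulf_neq0.
Qed.

End NonvanishingFunctional.

(** * At most two degenerate multipliers *)

Section DegenerateMultipliers.
Context {R : realType} {U : lmodType R[i]} {f g : U -> U -> R[i]}.
Hypotheses (hf : hermitian_form f) (hg : hermitian_form g).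

Definition pencil_kernel (l : R) (n : U) : Prop :=
  forall h, f n h + l%:C * g n h = 0.

Definition degenerate (l : R) : Prop :=
  (forall v, 0 <= quad f v + l * quad g v) /\
  exists2 n, n != 0 & pencil_kernel l n.

Lemma pencil_kernelP l n : (forall v, 0 <= quad f v + l * quad g v) ->
  quad f n + l * quad g n = 0 -> pencil_kernel l n.
Proof.
move=> psd n0; apply: (psd_kernel (hermitian_form_comb l hf hg)) => [v|].
  by rewrite /quad ReD ReMr; exact: psd.
by rewrite /quad ReD ReMr; exact: n0.
Qed.

Hypothesis fg0 :
  forall n, (forall h, f n h = 0) -> (forall h, g n h = 0) -> n = 0.

(** For [n] in the kernel at [l2], semidefiniteness at [l1] and [l3] forces [quad g n = 0]. Then [n]
    is also in the kernel at [l1], and subtracting the two kernel equations kills [g n h], hence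
    [f n h]. *)
Lemma degenerate_extreme l1 l2 l3 :
  l1 < l2 -> l2 < l3 -> degenerate l1 -> degenerate l2 -> degenerate l3 -> False.
Proof.
move=> l12 l23 [psd1 _] [_ [n n0 kn]] [psd3 _].
have k2 : quad f n + l2 * quad g n = 0 by rewrite /quad -ReMr -ReD kn.
have g0 : quad g n = 0 by have := psd1 n; have := psd3 n; nra.
have k1 : pencil_kernel l1 n by apply: pencil_kernelP => //; rewrite -k2 g0 !mulr0.
have gn h : g n h = 0.
  have : (l2 - l1)%:C * g n h = 0.
    by rewrite rmorphB mulrBl /= -[LHS]addr0 -{1}(k1 h) -[RHS](kn h); ring.
  by move/eqP; rewrite mulf_eq0 (inj_eq (@complexI R) _ 0) subr_eq0 gt_eqF //= => /eqP.
move/eqP: n0; apply; apply: fg0 => h //.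
by have := kn h; rewrite gn mulr0 addr0.
Qed.

Lemma degenerate_pair : exists l1 l2, forall l, degenerate l -> l = l1 \/ l = l2.
Proof.
have [[l1 d1]|no] := pselect (exists l, degenerate l); last first.
  by exists 0, 0 => l dl; case: no; exists l.
have [[l2 [d2 l12]]|no] := pselect (exists l, degenerate l /\ l1 != l); last first.
  exists l1, l1 => l dl; left; have [//|ne] := eqVneq l l1.
  by case: no; exists l; rewrite eq_sym.
exists l1, l2 => l dl; apply: contrapT => /not_orP[/eqP n1 /eqP n2].
have := @degenerate_extreme; move: n1 n2 l12; rewrite !neq_lt.
(* Every pattern of the three comparisons contains a strict chain through all three multipliers. *)
move=> /orP[] h1 /orP[] h2 /orP[] h3 X;
  solve [exact: (X _ _ _ h1 h3 dl d1 d2) | exact: (X _ _ _ h1 h2 d1 dl d2)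
  | exact: (X _ _ _ h3 h2 d1 d2 dl) | exact: (X _ _ _ h2 h3 dl d2 d1)
  | exact: (X _ _ _ h2 h1 d2 dl d1) | exact: (X _ _ _ h3 h1 d2 d1 dl)].
Qed.

End DegenerateMultipliers.

(** * Data excluding a multiplier, and differences of minimizers *)

Section Data.
Context {R : realType} {H K E : completeNormedModType R[i]}.
Context {fK : {hermitian_sym K for conjC}} {fE : {hermitian_sym E for conjC}}.
Context {T : {linear H -> K}} {V : {linear H -> E}}.
Hypotheses (krK : krein_space fK) (krE : krein_space fE).

Local Notation a := (fun x y : H => fK (T x) (T y)).
Local Notation b := (fun x y : H => fE (V x) (V y)).

Let hK := hermitian_sym_form fK.
Let hE := hermitian_sym_form fE.
Let ha : hermitian_form a := hermitian_form_pull fK T.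
Let hb : hermitian_form b := hermitian_form_pull fE V.

Lemma nonvanishing_data (l : R) (n : H) : l != 0 -> T n != 0 \/ V n != 0 ->
  exists M : set (K * E)%type, [/\ open M, dense M &
    forall w z, M (w, z) -> fK w (T n) + l%:C * fE z (V n) != 0].
Proof.
move=> l0 TVn; pose X : normedModType R[i] := (K * E)%type.
pose phi (p : X) : R[i]^o := fK p.1 (T n) + l%:C * fE p.2 (V n).
(* Nondegeneracy of [fK] or of [fE] provides [e], supported in a single factor; in the second case
   [l != 0] enters. *)
have [e phie] : exists e, phi e != 0.
  case: TVn => n0; apply: contrapT => ne.
    move/eqP: n0; apply; apply: (krein_nondegenerate krK) => u.
    rewrite (hformC hK); apply/eqP; rewrite conjc_eq0; apply: contraT => u0.
    by case: ne; exists (u, 0); rewrite /phi /= linear0l mulr0 addr0.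
  move/eqP: n0; apply; apply: (krein_nondegenerate krE) => u.
  rewrite (hformC hE); apply/eqP; rewrite conjc_eq0; apply: contraT => u0.
  case: ne; exists (0, u); rewrite /phi /= linear0l add0r mulf_neq0 //.
  by rewrite (inj_eq (@complexI R) _ 0).
have lin : linear phi.
  by move=> c p q; rewrite /phi /= !linearPl /= -[_ *: _]/(_ * _); ring.
have phic : continuous phi.
  move=> p; apply: cvgD.
    apply: (@cvg_comp _ _ _ fst (fun u => fK u (T n) : R[i]^o)); first exact: cvg_fst.
    exact: krein_continuous.
  apply: (cvgZl_tmp (k := l%:C) (f := fun q : X => fE q.2 (V n) : R[i]^o)).
  apply: (@cvg_comp _ _ _ snd (fun u => fE u (V n) : R[i]^o)); first exact: cvg_snd.
  exact: krein_continuous.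
have [oM dM] := nonvanishing_open_dense phic lin phie.
by exists [set p : X | phi p != 0]; split.
Qed.

(** Expand both forms at [y] around [x]. Objective and constraint values agree, and stationarity
    cancels the weighted cross terms, so [a + l b] vanishes at [y - x]; semidefiniteness puts this
    vector in the kernel. *)
Lemma minimizers_diff (w : K) (z : E) (x y : H) (l : R) :
  minimizers fK fE T V w z x -> minimizers fK fE T V w z y ->
  (forall v, 0 <= quad a v + l * quad b v) ->
  (forall h, fK (T x - w) (T h) + l%:C * fE (V x - z) (V h) = 0) ->
  pencil_kernel (f := a) (g := b) l (y - x).
Proof.
move=> /minimizersE[fx mx] /minimizersE[fy my] psd stat.
apply: (pencil_kernelP ha hb psd).
have eT : T y - w = (T x - w) + T (y - x).
  by rewrite linearB [RHS]addrC addrA subrK.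
have eV : V y - z = (V x - z) + V (y - x).
  by rewrite linearB [RHS]addrC addrA subrK.
have eK : quad (fK : K -> K -> R[i]) (T y - w) = quad (fK : K -> K -> R[i]) (T x - w).
  by apply/eqP; rewrite eq_le mx // my.
have := congr1 (@complex.Re R) (stat (y - x)); rewrite ReD ReMr /=.
move: fy eK; rewrite eT eV (quadD hE (V x - z)) (quadD hK (T x - w)) fx.
rewrite -[quad _ (T (y - x))]/(quad a (y - x)) -[quad _ (V (y - x))]/(quad b (y - x)).
nra.
Qed.

End Data.

Theorem theorem5p4 (R : realType) (H K E : completeNormedModType R[i])
    (ip : {dot H for conjC})
    (fK : {hermitian_sym K for conjC}) (fE : {hermitian_sym E for conjC})
    (T : {linear H -> K}) (V : {linear H -> E})
    (hH : hilbert_space ip) (hsep : separable H)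
    (hK : krein_space fK) (hE : krein_space fE)
    (hT : bounded_operator T) (hTrange : closed (range T))
    (hV : bounded_operator V) (hVsurj : range V = [set: E])
    (hTT : indefinite ip (adjoint ip fK T \o T))
    (hVV : indefinite ip (adjoint ip fE V \o V))
    (hNTV : nullspace T `&` nullspace V = [set 0])
    (hZ : forall (w : K) (z : E), minimizers fK fE T V w z !=set0) :
  exists M : set (K * E)%type,
    [/\ open M, dense M &
        forall (w : K) (z : E), M (w, z) ->
          exists x : H, minimizers fK fE T V w z = [set x]].
Proof.
have [[ap ap0] [an an0]] := indefinite_quad hTT.
have [bp bn] := indefinite_quad hVV.
pose a (x y : H) := fK (T x) (T y); pose b (x y : H) := fE (V x) (V y).
have ha : hermitian_form a := hermitian_form_pull fK T.
have hb : hermitian_form b := hermitian_form_pull fE V.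
(* For zero data the feasible set is a cone. Comparing the minimizer [x] with [2 x] shows that the
   minimum is nonnegative. *)
have ab v : quad b v = 0 -> 0 <= quad a v.
  have [x /minimizersE[]] := hZ 0 0; rewrite subr0 => bx mx bv.
  have := mx ((2 : R)%:C *: x); have := mx v.
  rewrite !subr0 linearZ_LR (linearZ_LR T) => /(_ bv) xv.
  rewrite (quadZr (hermitian_sym_form fE)) bx mulr0 => /(_ erefl).
  rewrite (quadZr (hermitian_sym_form fK)) => x2.
  by rewrite (le_trans _ xv) //; nra.
have mult w z x : minimizers fK fE T V w z x -> exists l : R,
    (forall v, 0 <= quad a v + l * quad b v) /\
    forall h, fK (T x - w) (T h) + l%:C * fE (V x - z) (V h) = 0.
  by apply: multiplier_exists => //; rewrite hVsurj.
have ab0 n : (forall h, a n h = 0) -> (forall h, b n h = 0) -> n = 0.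
  move=> an0' bn0; have Vn : V n = 0.
    apply: (krein_nondegenerate hE) => e.
    have [h _ <-] : range V e by rewrite hVsurj.
    exact: bn0.
  (* As [V n = 0], stationarity in the direction [n] reads [[T x - u, T n] = 0],
     for an arbitrary datum [u]. *)
  have Tn : T n = 0.
    apply: (krein_nondegenerate hK) => u; have [x mx] := hZ u 0.
    have [l [_ /(_ n)]] := mult _ _ _ mx.
    rewrite Vn linear0r mulr0 addr0 linearBl /= -[fK (T x) (T n)]/(a x n).
    rewrite (hformC ha) an0' rmorph0 sub0r => /eqP; rewrite oppr_eq0 => /eqP un.
    by rewrite (hformC (hermitian_sym_form fK)) un rmorph0.
  by have : (nullspace T `&` nullspace V) n by []; rewrite hNTV.
have [l1 [l2 l12]] := degenerate_pair ha hb ab0.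
(* For each fixed [l], generic data do not admit [l] as a degenerate multiplier; if [l] is not
   degenerate, all data qualify. *)
have avoid l : exists M : set (K * E)%type, [/\ open M, dense M &
    forall w z, M (w, z) ->
      forall x, (forall h, fK (T x - w) (T h) + l%:C * fE (V x - z) (V h) = 0) ->
      ~ degenerate (f := a) (g := b) l].
  have [[psd [n n0 kn]]|nd] := pselect (degenerate (f := a) (g := b) l); last first.
    exists setT; split=> //; first exact: openT.
    by move=> O O0 _; rewrite setIT.
  have l0 : l != 0.
    apply: contraTneq (psd an) => ->.
    by rewrite mul0r addr0 -ltNge.
  have TVn : T n != 0 \/ V n != 0.
    apply/orP; rewrite -negb_and; apply: contra n0 => /andP[/eqP Tn /eqP Vn].
    by apply/eqP; apply: ab0 => h; rewrite /a /b ?Tn ?Vn linear0l.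
  have [M [oM dM phiM]] := nonvanishing_data hK hE l0 TVn.
  (* Stationarity in the direction [n] loses its terms in [x], because [n] is in the kernel; what
     remains is the functional that is nonzero on [M]. *)
  exists M; split=> // w z /phiM phi0 x /(_ n); rewrite !linearBl /=.
  have : a x n + l%:C * b x n = 0.
    by rewrite (hformC ha) (hformC hb) -conjMr -rmorphD kn rmorph0.
  rewrite /a /b => e1 e2; move/eqP: phi0; case.
  apply/eqP; rewrite -oppr_eq0 -e2 -[X in _ == X]subr0 -[in X in _ == X]e1.
  by apply/eqP; ring.
have [M1 [oM1 dM1 M1P]] := avoid l1; have [M2 [oM2 dM2 M2P]] := avoid l2.
exists (M1 `&` M2); split; [exact: openI | exact: denseI |].
move=> w z [M1wz M2wz]; have [x mx] := hZ w z.
have [l [psd stat]] := mult _ _ _ mx.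
have nd : ~ degenerate (f := a) (g := b) l.
  move=> dl; case: (l12 l dl) => el; rewrite el in stat dl.
    exact: M1P M1wz _ stat dl.
  exact: M2P M2wz _ stat dl.
exists x; apply/seteqP; split=> [y my|_ ->//].
apply: contrapT => /eqP; rewrite -subr_eq0 => yx; apply: nd; split=> //.
by exists (y - x) => //; exact: minimizers_diff mx my psd stat.
Qed.
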